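(* Let $R\subseteq R_1$ and $R\subseteq R_2$ be two ring extensions such that $R$ is integrally closed in $R_1$ and in $R_2$, and regard $R\subseteq R_1\times R_2$ as a ring extension via the diagonal map. Then $R\subseteq R_1\times R_2$ has FCP (respectively, FIP) if and only if each $R\subseteq R_i$ ($i=1,2$) has FCP and $R$ is Artinian (respectively, each $R\subseteq R_i$ has FCP and $R$ has only finitely many ideals). In particular, the diagonal extension $R\subseteq R^2$ has FIP if and only if $R$ has only finitely many ideals.
   Context: All rings are commutative, unital and nonzero; ring morphisms are unital. For a ring extension $R\subseteq S$, $[R,S]$ denotes the set of all $R$-subalgebras of $S$ (i.e. subrings $T$ with $R\subseteq T\subseteq S$). The extension has FIP if $[R,S]$ is finite, and FCP if every chain (with respect to inclusion) of elements of $[R,S]$ is finite. *)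

(* Defs.v *)
From HB Require Import structures.
From mathcomp Require Import all_boot all_algebra.
From mathcomp Require Import boolp classical_sets cardinality.

Set Implicit Arguments.
Unset Strict Implicit.
Unset Printing Implicit Defensive.

Import GRing.Theory.

Local Open Scope classical_set_scope.
Local Open Scope ring_scope.

(* A ring extension of R by S is an injective ring morphism f : R -> S, the
   inclusion of R in S. *)

Section RingExtension.
Variables (R S : comNzRingType) (f : {rmorphism R -> S}).

(* The set [R, S]. *)
Definition intermediate_rings : set (set S) :=
  [set T | GRing.subring_closed [in T] /\ range f `<=` T].

Definition FIP : Prop := finite_set intermediate_rings.

Definition FCP : Prop :=
  forall C : set (set S), C `<=` intermediate_rings ->
    total_on C (fun T U => T `<=` U) -> finite_set C.

Definition integrally_closed_in : Prop :=
  forall x : S, integralOver f x -> range f x.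

End RingExtension.

Section Ideals.
Variable R : comNzRingType.

(* The library's idealr_closed only covers proper ideals; here the unit ideal
   is allowed. *)
Definition ideals : set (set R) :=
  [set I | GRing.zmod_closed [in I] /\
           forall a x : R, x \in I -> a * x \in I].

Definition artinian : Prop :=
  forall I : nat -> set R, (forall n, ideals (I n)) ->
    (forall n, I n.+1 `<=` I n) ->
    exists N, forall n, (N <= n)%N -> I n = I N.

End Ideals.

Arguments ideals R : clear implicits.

Section Diagonal.
Variables (R R1 R2 : comNzRingType).
Variables (f1 : {rmorphism R -> R1}) (f2 : {rmorphism R -> R2}).

Definition diag_map (x : R) : R1 * R2 := (f1 x, f2 x).

Fact diag_map_is_zmod_morphism : zmod_morphism diag_map.
Proof. by move=> x y; rewrite /diag_map !rmorphB. Qed.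

Fact diag_map_is_monoid_morphism : monoid_morphism diag_map.
Proof.
by split=> [|x y]; rewrite /diag_map ?rmorph1 // !rmorphM.
Qed.

HB.instance Definition _ :=
  GRing.isZmodMorphism.Build R (R1 * R2)%type diag_map
    diag_map_is_zmod_morphism.
HB.instance Definition _ :=
  GRing.isMonoidMorphism.Build R (R1 * R2)%type diag_map
    diag_map_is_monoid_morphism.

Definition diag : {rmorphism R -> (R1 * R2)%type} := diag_map.

End Diagonal.

(* Main.v *)
Require Import Defs.
From mathcomp Require Import all_boot all_algebra.
From mathcomp Require Import boolp classical_sets cardinality.

Set Implicit Arguments.
Unset Strict Implicit.
Unset Printing Implicit Defensive.

Import GRing.Theory.
Local Open Scope classical_set_scope.
Local Open Scope ring_scope.

(** The proof rests on a rigidity fact: if R is Artinian and integrally closed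
    in S, and R is a subring of S with FCP, then S = R
    ([FCP_integrally_closed_surjective]). Indeed the chain of subrings
    R[x] >= R[x^2] >= R[x^4] >= ... has finitely many terms, so
    x^m = p(x^(2m)) for some m and some polynomial p, and x is a root of a
    polynomial with a coefficient -1. Over an Artinian ring this forces x to be
    integral, hence in R. The point is that an Artinian ring is strongly
    pi-regular (a^n is a multiple of a^(n+1)), so that each coefficient is
    invertible on one part of Spec R and nilpotent on the complementary part;
    [monic_radical_coef] exploits this without decomposing R.

    Thus, if R is Artinian (for instance, if it has finitely many ideals) and both
    factors have FCP, the extension in question is just the
    diagonal one R <= R x R, whose intermediate rings correspond to the ideals
    of R: the ideal I gives the ring of pairs congruent modulo I
    ([congruence_ring], [conductor_ideal]). So FIP for the diagonal is the
    finiteness of the set of ideals, and FCP is the finiteness of all chains of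
    ideals. The latter is equivalent to R being Artinian, by the commutative
    Hopkins-Levitzki theorem ([artinian_chains_finite]).

    Conversely, [R, R1] embeds in [R, R1 x R2] by T |-> T x R2 (and
    symmetrically for R2), and the ideals of R embed in it by
    [congruence_ring]; so the finiteness of the chains, or of all the elements,
    of [R, R1 x R2] is inherited by them. *)

(** * Chains in families of sets *)

(** The common form of FCP, where the family is [R, S], and of the finiteness
    of the chains of ideals; it allows one transfer principle to serve both. *)
Definition chains_finite (T : Type) (F : set (set T)) : Prop :=
  forall C : set (set T), C `<=` F ->
    total_on C (fun A B => A `<=` B) -> finite_set C.

Lemma finite_set_inj (T U : Type) (F : set (set T)) (g : set T -> U) :
  (forall A B, F A -> F B -> g A = g B -> A = B) ->
  finite_set [set g A | A in F] -> finite_set F.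
Proof.
move=> g_inj fin_gF; pose h u := xget set0 [set A | F A /\ g A = u].
apply: sub_finite_set (finite_image h fin_gF) => A FA.
exists (g A); first by exists A.
have exA : exists B, F B /\ g B = g A by exists A.
have [FB gB] := xgetPex set0 exA.
exact: g_inj.
Qed.

Lemma finite_set_chains (T : Type) (F : set (set T)) :
  finite_set F -> chains_finite F.
Proof. by move=> fin_F C CF _; apply: sub_finite_set fin_F. Qed.

Lemma sub_chains_finite (T : Type) (F G : set (set T)) :
  F `<=` G -> chains_finite G -> chains_finite F.
Proof. by move=> FG finG C CF; apply: finG => A /CF /FG. Qed.

(** Modularity in the form used below: comparable members of F are told apart by
    the pair (g, h), so a chain embeds in the product of its two images, each of
    which is a chain in a family whose chains are finite. *)
Lemma chains_finite_separated (T U V : Type) (F : set (set T))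
    (G : set (set U)) (H : set (set V))
    (g : set T -> set U) (h : set T -> set V) :
  chains_finite G -> chains_finite H ->
  (forall A, F A -> G (g A)) -> (forall A, F A -> H (h A)) ->
  (forall A B, A `<=` B -> g A `<=` g B) ->
  (forall A B, A `<=` B -> h A `<=` h B) ->
  (forall A B, F A -> F B -> A `<=` B -> g B `<=` g A -> h B `<=` h A ->
     B `<=` A) ->
  chains_finite F.
Proof.
move=> finG finH FG FH g_mono h_mono sep C CF C_tot.
have fin_gC : finite_set [set g A | A in C].
  apply: finG => [_ [A /CF FA <-]|_ _ [A CA <-] [B CB <-]]; first exact: FG.
  by case: (C_tot A B CA CB) => /g_mono; [left | right].
have fin_hC : finite_set [set h A | A in C].
  apply: finH => [_ [A /CF FA <-]|_ _ [A CA <-] [B CB <-]]; first exact: FH.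
  by case: (C_tot A B CA CB) => /h_mono; [left | right].
apply: (@finite_set_inj _ _ C (fun A => (g A, h A))); last first.
  apply: sub_finite_set (finite_setX fin_gC fin_hC) => _ [A CA <-].
  by split; exists A.
move=> A B CA CB [gAB hAB].
by case: (C_tot A B CA CB) => sub; apply/seteqP; split=> //;
  apply: sep => //; try exact: CF; rewrite ?gAB ?hAB.
Qed.

Lemma chains_finite_embedding (T U : Type) (F : set (set T))
    (G : set (set U)) (g : set T -> set U) :
  chains_finite G -> (forall A, F A -> G (g A)) ->
  (forall A B, A `<=` B -> g A `<=` g B) ->
  (forall A B, F A -> F B -> g A = g B -> A = B) ->
  chains_finite F.
Proof.
move=> finG FG g_mono g_inj.
apply: (chains_finite_separated finG finG FG FG) => // A B FA FB AB gBA _.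
have gAB : g A = g B by apply/seteqP; split=> //; apply: g_mono.
by rewrite (g_inj A B FA FB gAB).
Qed.

Lemma finite_set_embedding (T U : Type) (F : set (set T))
    (G : set (set U)) (g : set T -> set U) :
  finite_set G -> (forall A, F A -> G (g A)) ->
  (forall A B, F A -> F B -> g A = g B -> A = B) -> finite_set F.
Proof.
move=> finG FG g_inj; apply: (finite_set_inj g_inj).
by apply: sub_finite_set finG => _ [A FA <-]; apply: FG.
Qed.

Lemma decreasing_seq_sub (T : Type) (A : nat -> set T) :
  (forall n, A n.+1 `<=` A n) -> forall m n, (m <= n)%N -> A n `<=` A m.
Proof.
move=> A_dec m n /subnK <-; elim: (n - m)%N => [|k IHk] //.
by rewrite addSn; apply: subset_trans (A_dec _) IHk.
Qed.

(** The terms of the sequence form a chain, hence take finitely many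
    values; choose an index k for each value, and let N bound these indices. *)
Lemma decreasing_seq_stationary (T : Type) (F : set (set T))
    (A : nat -> set T) :
  chains_finite F -> (forall n, F (A n)) -> (forall n, A n.+1 `<=` A n) ->
  exists N, forall n, (N <= n)%N -> A n = A N.
Proof.
move=> finF FA A_dec; have A_sub := decreasing_seq_sub A_dec.
have fin_A : finite_set (range A).
  apply: finF => [_ [n _ <-]|_ _ [m _ <-] [n _ <-]]; first exact: FA.
  by case/orP: (leq_total m n) => /A_sub; [right | left].
pose k X := xget 0%N [set n | A n = X].
have Ak n : A (k (A n)) = A n.
  exact: (xgetPex 0%N (ex_intro (fun m => A m = A n) n erefl)).
have /finite_seqP[s ks] := finite_image k fin_A.
exists (\max_(i <- s) i)%N => n le_n; apply/seteqP; split; first exact: A_sub.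
rewrite -(Ak n); apply: A_sub.
suff: k (A n) \in s by move=> ins; apply: (@leq_bigmax_seq _ _ predT id).
have : [set` s] (k (A n)) by rewrite -ks; exists (A n) => //; exists n.
by [].
Qed.

(** * Chains of ideals in an Artinian ring *)

Section Ideals.
Variable R : comNzRingType.
Implicit Types (I J K : set R) (a b c x y z : R).

Lemma idealsP I :
  ideals R I <->
  [/\ I 0, forall x y, I x -> I y -> I (x - y) & forall a x, I x -> I (a * x)].
Proof.
split=> [[[I0 IB] IM]|[I0 IB IM]].
- split=> [|x y Ix Iy|a x Ix]; first exact: set_mem.
  + by apply: set_mem; apply: IB; apply: mem_set.
  + by apply: set_mem; apply: IM; apply: mem_set.
- split; [split|]; first exact: mem_set.
  + by move=> x y /set_mem Ix /set_mem Iy; apply: mem_set; apply: IB.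
  + by move=> a x /set_mem Ix; apply: mem_set; apply: IM.
Qed.

Lemma ideal0 I : ideals R I -> I 0.
Proof. by case/idealsP. Qed.

Lemma idealB I x y : ideals R I -> I x -> I y -> I (x - y).
Proof. by case/idealsP=> _ + _; apply. Qed.

Lemma idealM I a x : ideals R I -> I x -> I (a * x).
Proof. by case/idealsP=> _ _; apply. Qed.

Lemma idealD I x y : ideals R I -> I x -> I y -> I (x + y).
Proof.
move=> idI Ix Iy; rewrite -[y]opprK; apply: idealB => //.
by rewrite -mulN1r; apply: idealM.
Qed.

Lemma ideals_setT : ideals R setT.
Proof. exact/idealsP. Qed.

Lemma ideals_setI I J : ideals R I -> ideals R J -> ideals R (I `&` J).
Proof.
move=> idI idJ; apply/idealsP; split=> [|x y [Ix Jx] [Iy Jy]|a x [Ix Jx]].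
- by split; apply: ideal0.
- by split; apply: idealB.
- by split; apply: idealM.
Qed.

Lemma ideals_mulr a I : ideals R I -> ideals R [set a * x | x in I].
Proof.
move=> idI; apply/idealsP; split=> [|_ _ [x Ix <-] [y Iy <-]|b _ [x Ix <-]].
- by exists 0; [apply: ideal0 | rewrite mulr0].
- by exists (x - y); [apply: idealB | rewrite mulrBr].
- by exists (b * x); [apply: idealM | rewrite mulrCA].
Qed.

Lemma ideals_ann a : ideals R [set x | a * x = 0].
Proof.
apply/idealsP; split=> [|x y /= ax0 ay0|b x /= ax0] /=.
- by rewrite mulr0.
- by rewrite mulrBr ax0 ay0 subr0.
- by rewrite mulrCA ax0 mulr0.
Qed.

Definition chains_below J : Prop :=
  chains_finite [set I | ideals R I /\ I `<=` J].

(** Dependent choice turns the descending chain condition on sequences into the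
    existence of minimal members of nonempty families. *)
Lemma artinian_minimal (F : set (set R)) J0 :
  artinian R -> F `<=` ideals R -> F J0 ->
  exists J, F J /\ forall I, F I -> I `<=` J -> I = J.
Proof.
move=> artR F_id FJ0; apply: contrapT => no_min.
have step (J : {J | F J}) : {I : {I | F I} | sval I `<` sval J}.
  apply: cid; apply: contrapT => J_min; apply: no_min; exists (sval J).
  split=> [|I FI IJ]; first exact: svalP.
  apply: contrapT => I_neq; apply: J_min; exists (exist _ I FI).
  by split=> //= JI; apply: I_neq; apply/seteqP.
have [u [_ u_dec]] := dependent_choice step (exist _ J0 FJ0).
have [||N uN] := artR (fun n => sval (u n)).
- by move=> n; apply: F_id; apply: svalP.
- by move=> n; have [] := u_dec n.
- have [_] := u_dec N; apply.
  by rewrite (uN N.+1).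
Qed.

(** The powers of a generate a decreasing, hence stationary, sequence of ideals. *)
Lemma artinian_strongly_pi_regular a :
  artinian R -> exists n b, a ^+ n = b * a ^+ n.+1.
Proof.
move=> artR; have [n|n _ [x _ <-]|N stab] :=
  artR (fun n => [set a ^+ n * x | x in setT]).
- exact/ideals_mulr/ideals_setT.
- by exists (a * x) => //; rewrite exprSr mulrA.
- have : [set a ^+ N * x | x in setT] (a ^+ N) by exists 1; rewrite ?mulr1.
  by rewrite -(stab N.+1) // => -[b _ ab]; exists N, b; rewrite mulrC ab.
Qed.

(** Multiplication by a identifies J / (J n ann a) with aJ, so finite length of the
    two ideals gives finite length of J. *)
Lemma chains_below_mulr J a : ideals R J ->
  chains_below (J `&` [set x | a * x = 0]) ->
  chains_below [set a * x | x in J] -> chains_below J.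
Proof.
move=> idJ finK finaJ.
apply: (chains_finite_separated finK finaJ
  (g := fun I => I `&` [set x | a * x = 0])
  (h := fun I => [set a * x | x in I])).
- move=> I [idI IJ]; split; first exact: ideals_setI (ideals_ann _).
  exact: setSI.
- move=> I [idI IJ]; split; first exact: ideals_mulr.
  exact: image_subset.
- by move=> I I' II'; apply: setSI.
- by move=> I I' II'; apply: image_subset.
- move=> I I' [idI IJ] [idI' I'J] II' ker_sub im_sub x I'x.
  have [y Iy ayx] : [set a * y | y in I] (a * x) by apply: im_sub; exists x.
  rewrite -[x](subrK y); apply: idealD => //.
  have [] // : (I `&` [set x | a * x = 0]) (x - y).
  apply: ker_sub; split; first by apply: idealB => //; apply: II'.
  by rewrite /= mulrBr ayx subrr.
Qed.

(** An ideal H maximal among those contained in J and avoiding x: enlarging H by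
    any further element y of J must capture x. When J is a vector space over a
    residue field of R, this makes H a hyperplane complementary to Rx. *)
Lemma hyperplane_avoiding J x : ideals R J -> x != 0 ->
  exists H, [/\ ideals R H, H `<=` J, ~ H x &
    forall y, J y -> ~ H y -> exists a, H (x - a * y)].
Proof.
move=> idJ x_neq0.
(* The empty set is admitted in P because the union of the empty chain must
   belong to P. *)
pose P := [set H : set R | (H !=set0 -> ideals R H) /\ H `<=` J /\ ~ H x].
have P_bigcup F : F `<=` P -> total_on F subset -> P (\bigcup_(H in F) H).
  move=> FP F_tot; split=> [[z [H0 FH0 H0z]]|]; last first.
    split=> [z [H FH Hz]|[H FH Hx]].
      by have [_ [HJ _]] := FP H FH; apply: HJ.
    by have [_ [_ ]] := FP H FH; apply.
  have F_id H y : F H -> H y -> ideals R H.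
    by move=> FH Hy; have [+ _] := FP H FH; apply; exists y.
  apply/idealsP; split=> [|y1 y2 [H1 FH1 Hy1] [H2 FH2 Hy2]|a y [H FH Hy]].
  - by exists H0 => //; apply: ideal0; apply: F_id H0z.
  - case: (F_tot H1 H2 FH1 FH2) => sub.
      exists H2 => //; apply: idealB => //; first exact: F_id Hy2.
      exact: sub.
    exists H1 => //; apply: idealB => //; first exact: F_id Hy1.
    exact: sub.
  - by exists H => //; apply: idealM => //; apply: F_id Hy.
have [H [[idH [HJ Hx]] Hmax]] := Zorn_bigcup P_bigcup.
have [H_neq0|H_eq0] := pselect (H !=set0); last first.
  case: (Hmax [set 0]).
    split; first by move=> z Hz; case: H_eq0; exists z.
    by move=> sub; apply: H_eq0; exists 0; apply: sub.
  split; last split.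
  - move=> _; apply/idealsP.
    split=> [|y z -> ->|a y ->] //=; first by rewrite subr0.
    by rewrite mulr0.
  - by move=> _ ->; apply: ideal0.
  - by move=> /= x0; rewrite x0 eqxx in x_neq0.
exists H; split=> // [|y Jy Hy]; first exact: idH.
have {H_neq0} idH' := idH H_neq0.
apply: contrapT => no_a.
pose H' := [set z | exists2 a, H (z - a * y) & True].
case: (Hmax H').
  split=> [z Hz|sub]; first by exists 0; rewrite // mul0r subr0.
  by apply: Hy; apply: sub; exists 1; rewrite // mul1r subrr; apply: ideal0.
split; last split.
- move=> _; apply/idealsP; split=> [|z1 z2 [a1 H1 _] [a2 H2 _]|b z [a Hz _]].
  + by exists 0; rewrite // mul0r subr0; apply: ideal0.
  + exists (a1 - a2) => //; rewrite mulrBl opprD addrACA -opprD.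
    exact: idealB.
  + by exists (b * a) => //; rewrite -mulrA -mulrBr; apply: idealM.
- move=> z [a Hz _]; rewrite -[z](subrK (a * y)); apply: idealD => //.
    exact: HJ.
  exact: idealM.
- by move=> [a Hxa _]; apply: no_a; exists a.
Qed.

Lemma chains_finite_artinian : chains_finite (ideals R) -> artinian R.
Proof.
by move=> finR I idI I_dec; apply: decreasing_seq_stationary finR idI I_dec.
Qed.

(** Let J be a minimal ideal below which some chain is infinite. If a in R
    satisfies neither aJ = 0 nor aJ = J, then J n ann a and aJ are both smaller
    than J, which contradicts [chains_below_mulr]. Hence an element of R that does
    not kill J acts surjectively, and then invertibly, on J: this makes J a
    vector space over the field R / ann J. A hyperplane H of J has only finite
    chains below it, by minimality, and a chain below J adds at most one jump to
    those of H, a contradiction. *)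
Lemma artinian_chains_finite : artinian R -> chains_finite (ideals R).
Proof.
move=> artR; apply: contrapT => infR.
have [||J [[idJ infJ] Jmin]] := @artinian_minimal
    [set J | ideals R J /\ ~ chains_below J] setT artR.
- by move=> J [].
- split=> [|fin]; first exact: ideals_setT.
  by apply: infR; apply: sub_chains_finite fin => I idI; split.
have below I : ideals R I -> I `<=` J -> I <> J -> chains_below I.
  by move=> idI IJ I_neq; apply: contrapT => infI; apply: I_neq; apply: Jmin.
have kill_or_onto a :
    (forall z, J z -> a * z = 0) \/
    (forall z, J z -> exists2 w, J w & z = a * w).
  have [aJ|aJ_neq] := pselect ([set a * x | x in J] = J).
    by right=> z; rewrite -{1}aJ => -[w Jw <-]; exists w.
  have [Ka|Ka_neq] := pselect (J `&` [set x | a * x = 0] = J).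
    by left=> z; rewrite -{1}Ka => -[].
  case: infJ; apply: (@chains_below_mulr _ a) => //; apply: below => //.
  - exact: ideals_setI (ideals_ann _).
  - exact: ideals_mulr.
  - by move=> _ [x Jx <-]; apply: idealM.
have inverse a z0 : J z0 -> a * z0 <> 0 ->
    exists b, forall z, J z -> b * (a * z) = z.
  move=> Jz0 az0; case: (kill_or_onto a) => [/(_ z0 Jz0) //|onto].
  have [n [b abn]] := artinian_strongly_pi_regular a artR.
  have onto_exp k : forall z, J z -> exists2 w, J w & z = a ^+ k * w.
    elim: k => [|k IHk] z Jz; first by exists z; rewrite ?mul1r.
    have [w Jw ->] := onto z Jz; have [v Jv ->] := IHk w Jw.
    by exists v => //; rewrite exprS mulrA.
  (* J = a^n J, and ba acts as the identity on a^n J. *)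
  exists b => z /(onto_exp n)[w _ ->].
  by rewrite [a * _]mulrA -exprS mulrA -abn.
have [x Jx x_neq0] : exists2 x, J x & x != 0.
  apply: contrapT => J0; apply: infJ; apply: finite_set_chains.
  apply: sub_finite_set (finite_set1 [set 0]) => I [idI IJ] /=.
  apply/seteqP; split=> [z Iz|_ ->]; last exact: ideal0.
  by apply: contrapT => /eqP z_neq0; apply: J0; exists z => //; apply: IJ.
have [H [idH HJ Hx Hcompl]] := hyperplane_avoiding idJ x_neq0.
have finH : chains_below H by apply: below => // HJeq; apply: Hx; rewrite HJeq.
apply: infJ.
(* An ideal I below J is determined, within a chain, by its trace on H together
   with the truth value of its inclusion in H, encoded as a set of units. *)
have fin_bool : chains_finite [set [set: unit]; set0].
  exact/finite_set_chains/finite_set2.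
apply: (chains_finite_separated finH fin_bool
  (g := fun I => I `&` H) (h := fun I => [set _ : unit | ~ I `<=` H])).
- move=> I [idI IJ]; split; first exact: ideals_setI.
  exact: subIsetr.
- move=> I _; have [IH|IH] := pselect (I `<=` H); [right|left].
    by apply/seteqP; split=> // _ [].
  by apply/seteqP; split.
- by move=> I I' II'; apply: setSI.
- by move=> I I' II' u /= IH I'H; apply: IH; apply: subset_trans I'H.
- move=> I I' [idI IJ] [idI' I'J] II' capH hI z I'z.
  have [I'H|I'H] := pselect (I' `<=` H).
    by have [] : (I `&` H) z by apply: capH; split=> //; apply: I'H.
  have /existsNP[y /not_implyP[Iy Hy]] : ~ I `<=` H by exact: hI tt I'H.
  have [Hz|Hz] := pselect (H z); first by have [] : (I `&` H) z by apply: capH.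
  (* Modulo H, both ay and cz equal x, so z and bay agree, b being the inverse
     of c on J. *)
  have [a Hxay] := Hcompl y (IJ y Iy) Hy.
  have [c Hxcz] := Hcompl z (I'J z I'z) Hz.
  have Jz := I'J z I'z.
  have [b bc] : exists b, forall z, J z -> b * (c * z) = z.
    apply: (inverse c z Jz) => cz0; apply: Hx.
    by rewrite -[x]subr0 -cz0.
  have Hdiff : H (z - b * a * y).
    have -> : z - b * a * y = b * ((x - a * y) - (x - c * z)).
      rewrite -{1}(bc z Jz) -mulrA -mulrBr; congr (b * _).
      by rewrite opprB [RHS]addrC addrA subrK.
    by apply: idealM => //; apply: idealB.
  have Iby : I (b * a * y) by apply: idealM.
  rewrite -[z](subrK (b * a * y)); apply: idealD => //.
  have [] // : (I `&` H) (z - b * a * y).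
  by apply: capH; split=> //; apply: idealB => //; apply: II'.
Qed.

End Ideals.

(** * Integrality over an Artinian ring *)

Section Integrality.
Variables (R S : comNzRingType) (f : {rmorphism R -> S}) (x : S).
Implicit Types (u v : S) (a b c : R) (p q h : {poly R}).

(** The elements of S that become nilpotent when all the values q(x) of monic
    polynomials q are inverted. It is a radical ideal of S, and it contains 1
    exactly when x is integral. *)
Definition monic_radical : set S :=
  [set u | exists q, q \is monic /\ exists n, u ^+ n * (map_poly f q).[x] = 0].

Lemma monic_radical1 : monic_radical 1 -> integralOver f x.
Proof.
case=> q [q_monic [n]]; rewrite expr1n mul1r => qx0.
by exists q => //; apply/rootP.
Qed.

Lemma monic_radical_mul u v : monic_radical u -> monic_radical (v * u).
Proof.
case=> q [q_monic [n qx0]]; exists q; split=> //; exists n.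
by rewrite exprMn -mulrA qx0 mulr0.
Qed.

Lemma monic_radicalD u v :
  monic_radical u -> monic_radical v -> monic_radical (u + v).
Proof.
(* In each term of the binomial expansion of (u + v)^(m + n), the exponent of u
   is at least m or that of v is at least n. *)
case=> p [p_monic [m px0]] [q [q_monic [n qx0]]].
exists (p * q); split; first by rewrite monicMl.
exists (m + n)%N; rewrite exprDn mulr_suml big1 // => i _.
rewrite rmorphM hornerM mulrnAl.
set t := (X in X *+ _); suff -> : t = 0 by rewrite mul0rn.
rewrite /t {t}.
case: (leqP n i) => [le_ni|lt_in].
  by rewrite -(subnK le_ni) exprD [X in X * _]mulrA mulrACA qx0 mulr0.
have le_m : (m <= m + n - i)%N by rewrite -addnBA ?leq_addr // ltnW.
rewrite -(subnK le_m) exprD -!mulrA [v ^+ i * _]mulrCA.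
by rewrite [u ^+ m * _]mulrA px0 mul0r mulr0.
Qed.

Lemma monic_radical_root u n : monic_radical (u ^+ n) -> monic_radical u.
Proof.
by case=> q [q_monic [m]]; rewrite -exprM; exists q; split=> //; exists (n * m)%N.
Qed.

Lemma monic_radical_monic u q :
  q \is monic -> monic_radical (u * (map_poly f q).[x]) -> monic_radical u.
Proof.
move=> q_monic [p [p_monic [n px0]]]; exists (q ^+ n * p).
split; first by rewrite monicMl ?monic_exp.
by exists n; rewrite rmorphM rmorphXn hornerM horner_exp mulrA -exprMn.
Qed.

(** By induction on the size of h it suffices to treat the coefficient a of X^n in
    h = a X^n + g. Since b a^(N+1) = a^N, the polynomial a^N b h equals a^N q with
    q = X^n + b g monic. So a^N q(x), then a^N, then a are in the radical ideal,
    and g(x) = h(x) - a x^n is as well. *)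
Lemma monic_radical_coef h : artinian R ->
  monic_radical (map_poly f h).[x] -> forall i, monic_radical (f h`_i).
Proof.
move=> artR.
move: {2}(size h) (leqnn (size h)) => n; elim: n h => [|n IHn] h le_hn hx.
  move: le_hn; rewrite leqn0 size_poly_eq0 => /eqP h0 i.
  by rewrite h0 coef0 rmorph0 -(mul0r (map_poly f h).[x]); apply: monic_radical_mul.
pose a := h`_n; pose g := h - a *: 'X^n.
have size_g : (size g <= n)%N.
  apply/leq_sizeP => i le_ni; rewrite coefB coefZ coefXn.
  case: eqVneq => [-> | neq_in]; first by rewrite mulr1 subrr.
  rewrite mulr0 subr0; move: le_hn => /leq_sizeP; apply.
  by rewrite ltn_neqAle eq_sym neq_in.
have [N [b abN]] := artinian_strongly_pi_regular a artR.
have q_monic : 'X^n + b *: g \is monic.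
  rewrite monicE lead_coefDl ?lead_coefXn // size_polyXn ltnS.
  exact: leq_trans (size_scale_leq _ _) size_g.
have fa : monic_radical (f a).
  apply: (@monic_radical_root _ N); apply: (monic_radical_monic q_monic).
  have -> : f a ^+ N * (map_poly f ('X^n + b *: g)).[x]
          = f (a ^+ N * b) * (map_poly f h).[x].
    rewrite -rmorphXn -!hornerZ -!map_polyZ; congr (map_poly f _).[x].
    have aba : a ^+ N * b * a = a ^+ N by rewrite mulrAC -exprSr mulrC -abN.
    by rewrite scalerDr scalerA /g scalerBr scalerA aba addrCA subrr addr0.
  exact: monic_radical_mul.
have gx : monic_radical (map_poly f g).[x].
  rewrite /g rmorphB hornerD /= hornerN map_polyZ hornerZ -mulrN mulrC.
  apply: monic_radicalD => //; exact: monic_radical_mul.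
move=> i; case: (eqVneq i n) => [-> //|neq_in].
have -> : h`_i = g`_i.
  by rewrite coefB coefZ coefXn (negbTE neq_in) mulr0 subr0.
exact: IHn.
Qed.

(** Over a field this says that a root of a nonzero polynomial is integral; over an
    Artinian ring, some coefficient has to be a unit. *)
Lemma integral_of_unit_coef h i : artinian R ->
  root (map_poly f h) x -> h`_i = -1 -> integralOver f x.
Proof.
move=> artR /rootP hx hi; apply: monic_radical1.
have hx' : monic_radical (map_poly f h).[x].
  rewrite hx; exists 1; split; first exact: monic1.
  by exists 1%N; rewrite mul0r.
rewrite -[1]opprK -mulN1r; apply: monic_radical_mul.
by have := monic_radical_coef artR hx' i; rewrite hi rmorphN1.
Qed.

End Integrality.

(** * Extensions of an Artinian ring with FCP *)

Section Extensions.
Variables (R S : comNzRingType) (f : {rmorphism R -> S}).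

Lemma intermediate_ringsP (T : set S) :
  intermediate_rings f T <->
  [/\ forall x y, T x -> T y -> T (x - y),
      forall x y, T x -> T y -> T (x * y) & forall a, T (f a)].
Proof.
split=> [[[_ TB TM] fT]|[TB TM fT]].
- split=> [x y Tx Ty|x y Tx Ty|a].
  + by apply: set_mem; apply: TB; apply: mem_set.
  + by apply: set_mem; apply: TM; apply: mem_set.
  + by apply: fT; exists a.
- split=> [|_ [a _ <-]]; last exact: fT.
  split=> [|x y /set_mem Tx /set_mem Ty|x y /set_mem Tx /set_mem Ty].
  + by apply: mem_set; rewrite -(rmorph1 f).
  + by apply: mem_set; apply: TB.
  + by apply: mem_set; apply: TM.
Qed.

Lemma FIP_FCP : FIP f -> FCP f.
Proof. exact: finite_set_chains. Qed.

Lemma surjective_FCP : (forall x, range f x) -> FCP f.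
Proof.
move=> f_surj; apply: FIP_FCP.
apply: sub_finite_set (finite_set1 setT) => T [_ fT].
by apply/seteqP; split=> // x _; apply: fT.
Qed.

(** The rings R[x^(2^n)] decrease with n, so x^m = p(x^(2m)) for some m = 2^N, and
    x is a root of p(X^(2m)) - X^m. The only term of degree m in this polynomial
    is - X^m, since 2m does not divide m. *)
Lemma FCP_integral x : artinian R -> FCP f -> integralOver f x.
Proof.
move=> artR finf.
pose A n := [set z | exists p : {poly R}, z = (map_poly f p).[x ^+ (2 ^ n)]].
have [|n _ [p ->]|N stab] := decreasing_seq_stationary finf (A := A).
- move=> n; apply/intermediate_ringsP.
  split=> [_ _ [p ->] [q ->]|_ _ [p ->] [q ->]|a].
  + by exists (p - q); rewrite rmorphB hornerD hornerN.
  + by exists (p * q); rewrite rmorphM hornerM.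
  + by exists a%:P; rewrite map_polyC hornerC.
- exists (p \Po 'X^2); rewrite map_comp_poly map_polyXn horner_comp hornerXn.
  by rewrite -exprM -expnSr.
have [p xN] : A N.+1 (x ^+ (2 ^ N)).
  by rewrite stab //; exists 'X; rewrite map_polyX hornerX.
have pow_gt0 k : (0 < 2 ^ k)%N by rewrite expn_gt0.
apply: (@integral_of_unit_coef _ _ f x
  (p \Po 'X^(2 ^ N.+1) - 'X^(2 ^ N)) (2 ^ N)) => //.
  rewrite /root rmorphB hornerD hornerN /= map_comp_poly !map_polyXn.
  by rewrite horner_comp !hornerXn -xN subrr.
rewrite coefB coefXn eqxx coef_comp_poly_Xn // gtnNdvd ?sub0r //.
by rewrite ltn_exp2l.
Qed.

Lemma FCP_integrally_closed_surjective x :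
  artinian R -> FCP f -> integrally_closed_in f -> range f x.
Proof. by move=> artR finf; apply; apply: FCP_integral. Qed.

End Extensions.

(** * The diagonal extension *)

Section DiagonalExtension.
Variables (R R1 R2 : comNzRingType).
Variables (f1 : {rmorphism R -> R1}) (f2 : {rmorphism R -> R2}).

Local Notation D := (diag f1 f2).

Definition congruence_ring (I : set R) : set (R1 * R2) :=
  [set z | exists a b, z = (f1 a, f2 b) /\ I (a - b)].

Definition conductor_ideal (T : set (R1 * R2)) : set R := [set a | T (f1 a, 0)].

Lemma congruence_ring_intermediate I :
  ideals R I -> intermediate_rings D (congruence_ring I).
Proof.
move=> idI; apply/intermediate_ringsP.
split=> [_ _ [a [b [-> Iab]]] [c [d [-> Icd]]]
        |_ _ [a [b [-> Iab]]] [c [d [-> Icd]]]|a].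
- exists (a - c), (b - d); split; first by rewrite !rmorphB.
  by rewrite opprD addrACA -opprD; apply: idealB.
- exists (a * c), (b * d); split; first by rewrite !rmorphM.
  have -> : a * c - b * d = c * (a - b) + b * (c - d).
    by rewrite !mulrBr addrA [c * b]mulrC subrK mulrC.
  by apply: idealD => //; apply: idealM.
- by exists a, a; split=> //; rewrite subrr; apply: ideal0.
Qed.

Lemma congruence_ringK : injective f1 -> injective f2 ->
  cancel congruence_ring conductor_ideal.
Proof.
move=> f1_inj f2_inj I; apply/seteqP; split=> [a [b [c [[]]]]|a Ia].
  by move=> /f1_inj-> /esym; rewrite -(rmorph0 f2) => /f2_inj->; rewrite subr0.
by exists a, 0; rewrite rmorph0 subr0.
Qed.

Lemma conductor_ideal_ideal T :
  intermediate_rings D T -> ideals R (conductor_ideal T).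
Proof.
case/intermediate_ringsP=> TB TM DT; apply/idealsP.
have pair_eq0 : (0 : R1 * R2) = (f1 0, 0) by rewrite rmorph0.
split=> [|a b Ta Tb|a b Tb]; rewrite /conductor_ideal /=.
- by rewrite -pair_eq0 -(rmorph0 D); apply: DT.
- by have := TB _ _ Ta Tb; rewrite rmorphB -[0 in X in _ -> X](subr0 0).
- by have := TM _ _ (DT a) Tb; rewrite rmorphM -[0 in X in _ -> X](mulr0 (f2 a)).
Qed.

(** Modulo the diagonal, the pair (f1 a, f2 b) equals (f1 (a - b), 0); so the
    conductor ideal decides which pairs belong to the ring. *)
Lemma conductor_ideal_inj :
  (forall x, range f1 x) -> (forall y, range f2 y) ->
  forall T U, intermediate_rings D T -> intermediate_rings D U ->
  conductor_ideal T = conductor_ideal U -> T = U.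
Proof.
move=> f1_surj f2_surj T U TR UR TU.
suff memE V : intermediate_rings D V ->
    forall a b, V (f1 a, f2 b) <-> conductor_ideal V (a - b).
  apply/seteqP; split=> -[x y]; have [a _ <-] := f1_surj x;
    by have [b _ <-] := f2_surj y; rewrite !memE // TU.
case/intermediate_ringsP=> VB _ DV a b; rewrite /conductor_ideal /=; split=> Vab.
  by have := VB _ _ Vab (DV b); rewrite rmorphB -[0 in X in _ -> X](subrr (f2 b)).
have -> : (f1 a, f2 b) = (f1 (a - b), 0) - D (- b).
  rewrite /diag /= /diag_map rmorphB !rmorphN.
  by congr (_, _); rewrite /= ?sub0r opprK ?subrK.
exact: VB.
Qed.

Lemma FCP_diag_ideals : injective f1 -> injective f2 ->
  FCP D -> chains_finite (ideals R).
Proof.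
move=> f1_inj f2_inj finD.
apply: (chains_finite_embedding finD congruence_ring_intermediate).
  by move=> I J IJ _ [a [b [-> /IJ Jab]]]; exists a, b.
by move=> I J _ _; apply/can_inj/congruence_ringK.
Qed.

Lemma FIP_diag_ideals : injective f1 -> injective f2 ->
  FIP D -> finite_set (ideals R).
Proof.
move=> f1_inj f2_inj finD.
apply: (finite_set_embedding finD congruence_ring_intermediate).
by move=> I J _ _; apply/can_inj/congruence_ringK.
Qed.

Lemma FCP_diag_surjective :
  (forall x, range f1 x) -> (forall y, range f2 y) ->
  chains_finite (ideals R) -> FCP D.
Proof.
move=> f1_surj f2_surj finR.
apply: (chains_finite_embedding finR conductor_ideal_ideal).
  by move=> T U TU a; apply: TU.
exact: conductor_ideal_inj.
Qed.

Lemma FIP_diag_surjective :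
  (forall x, range f1 x) -> (forall y, range f2 y) ->
  finite_set (ideals R) -> FIP D.
Proof.
move=> f1_surj f2_surj finR.
apply: (finite_set_embedding finR conductor_ideal_ideal).
exact: conductor_ideal_inj.
Qed.

Lemma FCP_diag_factors : FCP D -> FCP f1 /\ FCP f2.
Proof.
move=> finD; split.
- apply: (chains_finite_embedding finD (g := fun T => [set z | T z.1])).
  + move=> T /intermediate_ringsP[TB TM fT].
    apply/intermediate_ringsP; split=> [x y|x y|a] //=; first exact: TB.
    exact: TM.
  + by move=> T U TU z; apply: TU.
  + move=> T U _ _ TU; apply/seteqP; split=> x.
      by move=> Tx; have : [set z : R1 * R2 | T z.1] (x, 0) by []; rewrite TU.
    by move=> Ux; have : [set z : R1 * R2 | U z.1] (x, 0) by []; rewrite -TU.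
- apply: (chains_finite_embedding finD (g := fun T => [set z | T z.2])).
  + move=> T /intermediate_ringsP[TB TM fT].
    apply/intermediate_ringsP; split=> [x y|x y|a] //=; first exact: TB.
    exact: TM.
  + by move=> T U TU z; apply: TU.
  + move=> T U _ _ TU; apply/seteqP; split=> x.
      by move=> Tx; have : [set z : R1 * R2 | T z.2] (0, x) by []; rewrite TU.
    by move=> Ux; have : [set z : R1 * R2 | U z.2] (0, x) by []; rewrite -TU.
Qed.

End DiagonalExtension.

Theorem corollary2p5 (R : comNzRingType) :
  (forall (R1 R2 : comNzRingType)
     (f1 : {rmorphism R -> R1}) (f2 : {rmorphism R -> R2}),
     injective f1 -> injective f2 ->
     integrally_closed_in f1 -> integrally_closed_in f2 ->
     (FCP (diag f1 f2) <-> FCP f1 /\ FCP f2 /\ artinian R) /\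
     (FIP (diag f1 f2) <-> FCP f1 /\ FCP f2 /\ finite_set (ideals R)))
  /\ (FIP (diag (@idfun R) (@idfun R)) <-> finite_set (ideals R)).
Proof.
have ideals_artinian : finite_set (ideals R) -> artinian R.
  by move=> /finite_set_chains; apply: chains_finite_artinian.
split=> [R1 R2 f1 f2 f1_inj f2_inj f1_closed f2_closed|].
  split; split.
  - move=> finD; have [fin1 fin2] := FCP_diag_factors finD; split=> //; split=> //.
    exact/chains_finite_artinian/(FCP_diag_ideals f1_inj f2_inj).
  - case=> fin1 [fin2 artR].
    apply: (FCP_diag_surjective _ _ (artinian_chains_finite artR)) => x.
    + exact: FCP_integrally_closed_surjective.
    + exact: FCP_integrally_closed_surjective.
  - move=> finD; have [fin1 fin2] := FCP_diag_factors (FIP_FCP finD).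
    by split=> //; split=> //; apply: FIP_diag_ideals finD.
  - case=> fin1 [fin2 finR]; have artR := ideals_artinian finR.
    apply: FIP_diag_surjective => // x.
    + exact: FCP_integrally_closed_surjective.
    + exact: FCP_integrally_closed_surjective.
have id_surj x : range (@idfun R) x by exists x.
by split; [apply: FIP_diag_ideals | apply: FIP_diag_surjective].
Qed.
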